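(* For every integer $n\geq 2$ there exists a crystallographic group $\Gamma$ of dimension $n$ such that the center $Z(\Gamma)$ is trivial and the outer automorphism group $\operatorname{Out}(\Gamma)$ is trivial.
   Context: A crystallographic group of dimension $n$ is a discrete, cocompact subgroup of $\operatorname{Isom}(\mathbb{R}^n)=O(n)\ltimes\mathbb{R}^n$ (it is not required to be torsion free). For a group $\Gamma$, $Z(\Gamma)$ denotes its center and $\operatorname{Out}(\Gamma)=\operatorname{Aut}(\Gamma)/\operatorname{Inn}(\Gamma)$ is its group of outer automorphisms. *)

(* Defs.v *)
From HB Require Import structures.
From mathcomp Require Import all_boot all_order all_algebra.
From mathcomp Require Import all_classical all_reals all_analysis.

Set Implicit Arguments.
Unset Strict Implicit.
Unset Printing Implicit Defensive.

Import GRing.Theory.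
Import numFieldNormedType.Exports.
Local Open Scope quotient_scope.
Local Open Scope classical_set_scope.
Local Open Scope ring_scope.

(* Isom(R^n) = O(n) |x R^n: the pair (A, a) stands for the map x |-> A x + a. *)
Record eisom (R : realType) (n : nat) := EIsom {
  eisom_val : 'M[R]_n * 'cV[R]_n ;
  eisom_orthogonal : eisom_val.1 *m eisom_val.1^T == 1%:M
}.

Section EIsomGroup.
Variables (R : realType) (n : nat).
Local Notation E := (eisom R n).

HB.instance Definition _ := [isSub for @eisom_val R n].
HB.instance Definition _ := [Choice of E by <:].

Definition eisom_lin (g : E) : 'M[R]_n := (eisom_val g).1.
Definition eisom_trans (g : E) : 'cV[R]_n := (eisom_val g).2.

Definition eisom_act (g : E) (x : 'cV[R]_n) : 'cV[R]_n :=
  eisom_lin g *m x + eisom_trans g.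

Lemma eisom_linKr (g : E) : eisom_lin g *m (eisom_lin g)^T = 1%:M.
Proof. exact/eqP/(eisom_orthogonal g). Qed.

Lemma eisom_linKl (g : E) : (eisom_lin g)^T *m eisom_lin g = 1%:M.
Proof. exact/mulmx1C/eisom_linKr. Qed.

Lemma eisom_ext (g h : E) :
  eisom_lin g = eisom_lin h -> eisom_trans g = eisom_trans h -> g = h.
Proof.
case: g h => [[A a] ?] [[B b] ?]; rewrite /eisom_lin /eisom_trans /= => AB ab.
by apply: val_inj; rewrite /= AB ab.
Qed.

Fact eisom_one_proof :
  (1%:M, 0 : 'cV[R]_n).1 *m ((1%:M, 0 : 'cV[R]_n).1)^T == 1%:M :> 'M[R]_n.
Proof. by rewrite /= trmx1 mulmx1. Qed.
Definition eisom_one : E := EIsom eisom_one_proof.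

Definition eisom_mul_val (g h : E) : 'M[R]_n * 'cV[R]_n :=
  (eisom_lin g *m eisom_lin h, eisom_lin g *m eisom_trans h + eisom_trans g).
Fact eisom_mul_proof g h :
  (eisom_mul_val g h).1 *m ((eisom_mul_val g h).1)^T == 1%:M.
Proof.
rewrite /= trmx_mul mulmxA -[_ *m eisom_lin h *m _]mulmxA.
by rewrite eisom_linKr mulmx1 eisom_linKr.
Qed.
Definition eisom_mul g h : E := EIsom (eisom_mul_proof g h).

Definition eisom_inv_val (g : E) : 'M[R]_n * 'cV[R]_n :=
  ((eisom_lin g)^T, - ((eisom_lin g)^T *m eisom_trans g)).
Fact eisom_inv_proof g : (eisom_inv_val g).1 *m ((eisom_inv_val g).1)^T == 1%:M.
Proof. by rewrite /= trmxK eisom_linKl. Qed.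
Definition eisom_inv g : E := EIsom (eisom_inv_proof g).

Fact eisom_mulA : associative eisom_mul.
Proof.
move=> f g h; apply: eisom_ext; first exact: mulmxA.
by rewrite /eisom_trans /= /eisom_lin /= mulmxDr mulmxA addrA.
Qed.
Fact eisom_mul1 : left_id eisom_one eisom_mul.
Proof.
move=> g; apply: eisom_ext; first exact: mul1mx.
by rewrite /eisom_trans /= /eisom_lin /= mul1mx addr0.
Qed.
Fact eisom_mulr1 : right_id eisom_one eisom_mul.
Proof.
move=> g; apply: eisom_ext; first exact: mulmx1.
by rewrite /eisom_trans /= mulmx0 add0r.
Qed.
Fact eisom_mulV : left_inverse eisom_one eisom_inv eisom_mul.
Proof.
move=> g; apply: eisom_ext; first exact: eisom_linKl.
by rewrite /eisom_trans /= /eisom_lin /= subrr.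
Qed.
Fact eisom_mulrV : right_inverse eisom_one eisom_inv eisom_mul.
Proof.
move=> g; apply: eisom_ext; first exact: eisom_linKr.
by rewrite /eisom_trans /= mulmxN mulmxA eisom_linKr mul1mx addNr.
Qed.
HB.instance Definition _ :=
  isGroup.Build E eisom_mulA eisom_mul1 eisom_mulr1 eisom_mulV eisom_mulrV.

Lemma eisom_actM (g h : E) (x : 'cV[R]_n) :
  eisom_act (g * h)%g x = eisom_act g (eisom_act h x).
Proof. by rewrite /eisom_act mulmxDr mulmxA addrA. Qed.

HB.instance Definition _ :=
  Topological.copy E (initial_topology (@eisom_val R n)).

End EIsomGroup.

Section Subgroup.
Variables (G : groupType) (H : groupClosed G).

Definition subgroup_type := {x : G | x \in H}.
HB.instance Definition _ := SubChoice.on subgroup_type.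

Fact subgroup_closed : group_closed (fun x : G => x \in H).
Proof. by split; [exact: gpred1 | move=> x y; exact: gpredF]. Qed.
HB.instance Definition _ :=
  SubChoice_isSubGroup.Build G _ subgroup_type subgroup_closed.

Definition lcoset_rel : rel G := fun x y => (x^-1 * y)%g \in H.

Fact lcoset_rel_refl : reflexive lcoset_rel.
Proof. by move=> x; rewrite /lcoset_rel mulVg gpred1. Qed.
Fact lcoset_rel_sym : symmetric lcoset_rel.
Proof. by move=> x y; rewrite /lcoset_rel -gpredV invgM invgK. Qed.
Fact lcoset_rel_trans : transitive lcoset_rel.
Proof.
move=> y x z; rewrite /lcoset_rel => xy yz.
by rewrite -(mulgK y x^-1%g) -mulgA gpredM.
Qed.
Canonical lcoset_equiv :=
  EquivRel lcoset_rel lcoset_rel_refl lcoset_rel_sym lcoset_rel_trans.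

End Subgroup.

Section OuterAutomorphisms.
Variable G : groupType.

Definition group_center : set G := [set z | forall x, commute z x].

Definition automorphisms : set (G -> G) :=
  [set f | bijective f /\ {morph f : x y / (x * y)%g}].

Definition inner_automorphisms : set (G -> G) :=
  [set (fun x => x ^ g)%g | g in [set: G]].

(* The underlying set of Aut(G)/Inn(G), as the set of cosets f Inn(G). *)
Definition outer_automorphisms : set (set (G -> G)) :=
  [set [set f \o i | i in inner_automorphisms] | f in automorphisms].

End OuterAutomorphisms.

Arguments group_center : clear implicits.
Arguments automorphisms : clear implicits.
Arguments inner_automorphisms : clear implicits.
Arguments outer_automorphisms : clear implicits.

Section Crystallographic.
Variables (R : realType) (n : nat) (H : groupClosed (eisom R n)).

Definition discrete_subgroup : Prop :=
  forall g : eisom R n, g \in H -> isolated [set h | h \in H] g.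

Definition coset_space : topologicalType :=
  quotient_topology {eq_quot (lcoset_equiv H)}.

Definition cocompact_subgroup : Prop := compact [set: coset_space].

Definition crystallographic : Prop := discrete_subgroup /\ cocompact_subgroup.

End Crystallographic.

(* Main.v *)
Require Import Defs.
From mathcomp Require Import all_boot all_order all_algebra.
From mathcomp Require Import all_classical all_reals all_analysis.
From mathcomp Require Import perm lra zify.

(* Gamma is the group of all isometries preserving a lattice L: the
   body-centered cubic one for n >= 3, the hexagonal one for n = 2.  The
   translations of Gamma are the elements commuting with all their conjugates,
   so an automorphism f induces a linear map Phi of L.  Phi normalizes the
   point group O(L), which acts absolutely irreducibly, so Phi is a similarity,
   and comparing minimal norms shows that it is an isometry: Phi lies in O(L).
   Correcting f by Phi, we may assume that f is the identity on translations.
   Then f sends the point reflection -1 to x |-> c - x, where c is fixed by O(L)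
   modulo 2L; for these lattices this forces c in 2L, and after conjugating by
   the translation c/2, f is the identity. *)

Set Implicit Arguments.
Unset Strict Implicit.
Unset Printing Implicit Defensive.

Import Order.TTheory GRing.Theory Num.Theory.
Import numFieldNormedType.Exports.
Local Open Scope quotient_scope.
Local Open Scope classical_set_scope.
Local Open Scope ring_scope.

(** * Stabilizers of sets of vectors in the isometry group *)

Section LatticeGroup.
Variables (R : realType) (n : nat).
Implicit Types (L : set 'cV[R]_n) (g h : eisom R n).

(** An equivalence rather than an implication, so that closure under inverses is immediate. *)
Definition lattice_stab L : {pred eisom R n} :=
  fun g => `[< forall x, L (eisom_act g x) <-> L x >].

Fact lattice_stab_closed L : group_closed (lattice_stab L).
Proof.
split=> [|g h /asboolP Lg /asboolP Lh].
  by apply/asboolP => x; rewrite /eisom_act mul1mx addr0.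
apply/asboolP => x; rewrite eisom_actM Lg.
by rewrite -(Lh (eisom_act h^-1%g x)) -eisom_actM mulgV /eisom_act mul1mx addr0.
Qed.

Definition lattice_group L : groupClosed (eisom R n) :=
  GroupClosed.Pack (GroupClosed.Class
    (isInvClosed.Build _ _ (group_closedV (lattice_stab_closed L)))
    (isMul1Closed.Build _ _ (fst (lattice_stab_closed L)))
    (isMulClosed.Build _ _ (group_closedM (lattice_stab_closed L)))).

Lemma lattice_groupP L g :
  reflect (forall x, L (eisom_act g x) <-> L x) (g \in lattice_group L).
Proof. exact: asboolP. Qed.

Definition orthogonal_isom (A : 'M[R]_n) (AA : A *m A^T = 1%:M) : eisom R n :=
  @EIsom R n (A, 0) (introT eqP AA).

Fact translation_proof (v : 'cV[R]_n) :
  (1%:M, v).1 *m ((1%:M, v).1)^T == 1%:M :> 'M[R]_n.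
Proof. by rewrite trmx1 mulmx1. Qed.
Definition translation v : eisom R n := EIsom (translation_proof v).

Lemma eisom_linM g h : eisom_lin (g * h)%g = eisom_lin g *m eisom_lin h.
Proof. by []. Qed.

Lemma eisom_transM g h :
  eisom_trans (g * h)%g = eisom_lin g *m eisom_trans h + eisom_trans g.
Proof. by []. Qed.

Lemma eisom_linV g : eisom_lin g^-1%g = (eisom_lin g)^T.
Proof. by []. Qed.

Definition lattice_symmetry L (A : 'M[R]_n) :=
  A *m A^T = 1%:M /\ forall x, L (A *m x) <-> L x.

Lemma eisom_translationC g v :
  (g * translation v = translation (eisom_lin g *m v) * g)%g.
Proof.
apply: eisom_ext; first by rewrite !eisom_linM mulmx1 mul1mx.
by rewrite !eisom_transM mul1mx addrC.
Qed.

Lemma translationD u v :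
  translation (u + v) = (translation u * translation v)%g.
Proof.
apply: eisom_ext; first by rewrite eisom_linM mulmx1.
by rewrite eisom_transM mul1mx addrC.
Qed.

Lemma trmx_mul_self_eq0 m k (A : 'M[R]_(m, k)) : A^T *m A = 0 -> A = 0.
Proof.
move=> A0; apply/matrixP => i j.
have /eqP : (A^T *m A) j j = 0 by rewrite A0 mxE.
rewrite mxE psumr_eq0; last by move=> l _; rewrite mxE -expr2 sqr_ge0.
by move/allP/(_ i (mem_index_enum _)); rewrite mxE mulf_eq0 orbb mxE => /eqP.
Qed.

(** For B = 1 - A, orthogonality gives B^T = - A^T B, hence B^T B = - A^T B^2 = 0 and B = 0. *)
Lemma orthogonal_unipotent (A : 'M[R]_n) :
  A *m A^T = 1%:M -> (1%:M - A) *m (1%:M - A) = 0 -> A = 1%:M.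
Proof.
move=> AA A0; apply/eqP; rewrite eq_sym -subr_eq0; apply/eqP.
apply: trmx_mul_self_eq0; rewrite [(_ - _)^T]linearB /= trmx1.
have -> : 1%:M - A^T = - (A^T *m (1%:M - A)).
  by rewrite mulmxBr mulmx1 (mulmx1C AA) opprB.
by rewrite mulNmx -mulmxA A0 mulmx0 oppr0.
Qed.

End LatticeGroup.

(** * The lattice L and its additive maps *)

Section CenteredLattice.
Variables (R : realType) (n : nat) (d : 'I_n -> R).
Hypothesis d_gt0 : forall i, 0 < d i.

(* For d = 1 this is the body-centered cubic lattice, for n = 2 and
   d = (1, sqrt 3) the hexagonal one. *)
Definition centered : set 'cV[R]_n :=
  [set x | exists2 z : 'I_n -> int, forall i, x i 0 = d i * (z i)%:~R &
     forall i j, (2 %| z i - z j)%Z].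

Local Notation L := centered.

Lemma centered0 : L 0.
Proof. by exists (fun=> 0) => [i|i j]; rewrite ?mxE ?mulr0 ?subrr ?dvdz0. Qed.

Lemma centeredB x y : L x -> L y -> L (x - y).
Proof.
move=> [z xz z2] [t yt t2]; exists (fun i => z i - t i) => [i|i j].
  by rewrite !mxE xz yt rmorphB mulrBr.
have -> : z i - t i - (z j - t j) = (z i - z j) - (t i - t j) by lia.
exact: rpredB.
Qed.

Lemma centeredN x : L x -> L (- x).
Proof.
by move=> Lx; rewrite -sub0r; apply: centeredB => //; exact: centered0.
Qed.

Lemma centeredD x y : L x -> L y -> L (x + y).
Proof. by move=> Lx Ly; rewrite -[y]opprK; apply/centeredB/centeredN. Qed.

(** These vectors span a sublattice of L containing 2L; being multiples of the standard basis, they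
    replace a basis of L in what follows. *)
Definition centered_vec (i : 'I_n) : 'cV[R]_n := (2 * d i) *: delta_mx i 0.

Lemma centered_vecP i : L (centered_vec i).
Proof.
exists (fun j => 2 * (j == i)%:Z) => [j|j k].
  by rewrite !mxE eqxx andbT; case: eqP => [->|_] /=; lra.
by rewrite -mulrBr dvdz_mulr.
Qed.

Lemma centered_eqmx m (A B : 'M[R]_(m, n)) :
  (forall x, L x -> A *m x = B *m x) -> A = B.
Proof.
move=> AB; apply/matrixP => i j.
have := AB _ (centered_vecP j); rewrite -!scalemxAr.
move=> /(congr1 (fun x : 'cV__ => x i 0)).
rewrite -!colE !mxE; apply: mulfI; apply: lt0r_neq0.
by rewrite mulr_gt0.
Qed.

Lemma centered_double x : L x ->
  exists z : 'I_n -> int, x *+ 2 = \sum_i centered_vec i *~ z i.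
Proof.
move=> [z xz _]; exists z; apply/colP => j.
rewrite mulr2n !mxE summxE (bigD1 j) //= big1 => [|i ij].
  rewrite addr0 -scaler_int !mxE !eqxx xz /= mulr1 mulrCA mulrA.
    lra.
by rewrite -scaler_int !mxE eq_sym (negPf ij) !mulr0.
Qed.

(** The columns of A are read off from the values at [centered_vec]. Since 2x is an integral
    combination of these vectors, phi and A agree at 2x, and halving is harmless over R. *)
Lemma centered_additive (phi : 'cV[R]_n -> 'cV[R]_n) :
  (forall x y, L x -> L y -> phi (x + y) = phi x + phi y) ->
  exists A : 'M[R]_n, forall x, L x -> phi x = A *m x.
Proof.
move=> phiD.
pose A := \matrix_(i, j) (phi (centered_vec j) i 0 / (2 * d j)).
have phi0 : phi 0 = 0.
  by apply: (@addrI _ (phi 0)); rewrite -phiD ?addr0 //; exact: centered0.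
have phiN x : L x -> phi (- x) = - phi x.
  move=> Lx; apply: (@addrI _ (phi x)).
  by rewrite -phiD ?subrr //; exact: centeredN.
have LMn x k : L x -> L (x *+ k).
  move=> Lx; elim: k => [|k IH]; first exact: centered0.
  by rewrite mulrS; exact: centeredD.
have phiMn x k : L x -> phi (x *+ k) = phi x *+ k.
  move=> Lx; elim: k => [|k IH]; first by rewrite phi0.
  by rewrite !mulrS phiD ?IH //; exact: LMn.
have LMz x k : L x -> L (x *~ k).
  by case: k => k Lx; [exact: LMn|apply/centeredN/LMn].
have phiMz x k : L x -> phi (x *~ k) = phi x *~ k.
  case: k => k Lx; first exact: phiMn.
  by rewrite !NegzE !mulrNz phiN ?phiMn //; exact: LMn.
have phiA i : phi (centered_vec i) = A *m centered_vec i.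
  rewrite -scalemxAr -colE; apply/colP => k; rewrite !mxE mulrC divfK //.
  by rewrite lt0r_neq0 // mulr_gt0.
exists A => x Lx.
have /= phi2 : phi (x *+ 2) = A *m (x *+ 2).
  have [z ->] := centered_double Lx.
  rewrite mulmx_sumr.
  (* As phi is additive on L only, the induction also carries membership of the partial sums in
     L. *)
  have : forall s : seq 'I_n, L (\sum_(i <- s) centered_vec i *~ z i) /\
      phi (\sum_(i <- s) centered_vec i *~ z i) =
      \sum_(i <- s) A *m (centered_vec i *~ z i).
    elim=> [|i s [Ls IH]].
      by rewrite !big_nil; split=> //; exact: centered0.
    have Lz : L (centered_vec i *~ z i) by apply/LMz/centered_vecP.
    rewrite !big_cons; split; first exact: centeredD.
    rewrite phiD // IH phiMz; last exact: centered_vecP.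
    by rewrite phiA raddfMz.
  by move/(_ (index_enum _))=> [].
move: phi2; rewrite phiMn // raddfMn /= => phi2.
by apply/colP => i; move/colP/(_ i): phi2; rewrite !mulr2n !mxE; lra.
Qed.

End CenteredLattice.

(** * Translations, center, and the linear map induced by an automorphism *)

Section CenteredGroup.
Variables (R : realType) (n : nat) (d : 'I_n -> R).
Hypothesis d_gt0 : forall i, 0 < d i.

Local Notation L := (centered d).
Local Notation Gamma := (lattice_group L).
Local Notation G := (subgroup_type Gamma).

Lemma translation_in v : L v -> translation v \in Gamma.
Proof.
move=> Lv; apply/lattice_groupP => x; rewrite /eisom_act mul1mx.
split=> [Lxv|Lx]; last exact: centeredD.
by rewrite -[x](addrK v); exact: centeredB.
Qed.

Lemma eisom_trans_in g : g \in Gamma -> L (eisom_trans g).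
Proof.
move=> /lattice_groupP /(_ 0) [_]; rewrite /eisom_act mulmx0 add0r; apply.
exact: centered0.
Qed.

Lemma eisom_lin_symmetry g : g \in Gamma -> lattice_symmetry L (eisom_lin g).
Proof.
move=> Gg; split; first exact: eisom_linKr.
move=> x; move/lattice_groupP: (Gg) => /(_ x) <-; rewrite /eisom_act.
have Lt := eisom_trans_in Gg.
split=> [Lx|Lx]; first exact: centeredD.
by rewrite -[_ *m x](addrK (eisom_trans g)); exact: centeredB.
Qed.

Lemma orthogonal_isom_in A (AA : A *m A^T = 1%:M) :
  (forall x, L (A *m x) <-> L x) -> orthogonal_isom AA \in Gamma.
Proof. by move=> AL; apply/lattice_groupP => x; rewrite /eisom_act addr0. Qed.

Lemma opp_symmetry : lattice_symmetry L (- 1%:M).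
Proof.
split; first by rewrite linearN /= trmx1 mulNmx mulmxN opprK mulmx1.
move=> x; rewrite mulNmx mul1mx; split; last exact: centeredN.
by move=> /centeredN; rewrite opprK.
Qed.

(** Made total by the default value 1 outside L; the lemmas about it therefore assume [L v]. *)
Definition gtransl (v : 'cV[R]_n) : G := insubd (1%g : G) (translation v).

Lemma val_gtransl v : L v -> val (gtransl v) = translation v.
Proof. by move=> Lv; rewrite val_insubd translation_in. Qed.

Definition gorth (A : 'M[R]_n) (AA : A *m A^T = 1%:M) : G :=
  insubd (1%g : G) (orthogonal_isom AA).

Lemma val_gorth A (AA : A *m A^T = 1%:M) :
  (forall x, L (A *m x) <-> L x) -> val (gorth AA) = orthogonal_isom AA.
Proof. by move=> AL; rewrite val_insubd orthogonal_isom_in. Qed.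

Lemma gtransl_inj u v : L u -> L v ->
  gtransl u = gtransl v -> u = v.
Proof.
by move=> Lu Lv /(congr1 (fun g : G => eisom_trans (val g))); rewrite !val_gtransl.
Qed.

Lemma val_subM (g h : G) : val (g * h)%g = (val g * val h)%g.
Proof. by []. Qed.

Lemma gtranslD u v : L u -> L v ->
  gtransl (u + v) = (gtransl u * gtransl v)%g.
Proof.
move=> Lu Lv; apply: val_inj; rewrite val_subM !val_gtransl //; last exact: centeredD.
exact: translationD.
Qed.

Lemma gtranslC (g : G) v : L v ->
  (g * gtransl v = gtransl (eisom_lin (val g) *m v) * g)%g.
Proof.
move=> Lv; have [_ gL] := eisom_lin_symmetry (valP g).
apply: val_inj; rewrite !val_subM !val_gtransl //; last exact/gL.
exact: eisom_translationC.
Qed.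

Lemma gtranslP (g : G) : eisom_lin (val g) = 1%:M ->
  g = gtransl (eisom_trans (val g)).
Proof.
move=> g1; apply: val_inj; rewrite val_gtransl; last exact/eisom_trans_in/(valP g).
exact: eisom_ext.
Qed.

(** Commuting with all translations forces the linear part to fix L pointwise, so a central element
    is a translation by some t; commuting with the point reflection then gives t = - t. *)
Lemma center_centered : group_center G = [set 1%g].
Proof.
apply/seteqP; split=> [g gC|_ -> h]; last by rewrite /commute mul1g mulg1.
have g1 : eisom_lin (val g) = 1%:M.
  apply: (centered_eqmx d_gt0) => x Lx; rewrite mul1mx.
  have := gC (gtransl x); rewrite /commute gtranslC //.
  move=> /mulIg /gtransl_inj; apply=> //.
  by have [_ ->] := eisom_lin_symmetry (valP g).
have [NN NL] := opp_symmetry.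
rewrite /= (gtranslP g1); have Lt := eisom_trans_in (valP g).
have := gC (gorth NN); rewrite /commute {1 2}(gtranslP g1) gtranslC //.
rewrite val_gorth // => /mulIg /gtransl_inj => /(_ Lt).
rewrite /eisom_lin /= mulNmx mul1mx => /(_ (centeredN Lt)) t0.
have -> : eisom_trans (val g) = 0.
  by apply/colP => i; move/colP/(_ i): t0; rewrite !mxE; lra.
apply: val_inj; rewrite val_gtransl; last exact: centered0.
exact: eisom_ext.
Qed.

(* A translation t by x conjugates g = (A, a) to (A, A x + a - x), which commutes
   with g only if (1 - A)^2 x = 0. *)
Lemma commute_conjP (g : G) :
  eisom_lin (val g) = 1%:M <-> forall h, commute g (g ^ h)%g.
Proof.
split=> [g1 h|gC].
  have gh1 : eisom_lin (val (g ^ h)%g) = 1%:M.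
    by rewrite /= !eisom_linM g1 mul1mx eisom_linV eisom_linKl.
  move: (g ^ h)%g gh1 => k k1.
  rewrite (gtranslP g1) (gtranslP k1) /commute -!gtranslD 1?addrC //;
    by apply: eisom_trans_in; exact: (valP _).
apply: orthogonal_unipotent; first exact: eisom_linKr.
apply: (centered_eqmx d_gt0) => x Lx; rewrite mul0mx.
have := gC (gtransl x); rewrite /commute => /(congr1 val).
rewrite !val_subM /=.
have -> : sval (gtransl x) = translation x by exact: val_gtransl.
move/(congr1 (@eisom_trans R n)); rewrite !eisom_transM !eisom_linM eisom_linV.
move: (sval g) => {gC}g.
rewrite /eisom_trans /eisom_lin /= trmx1 !mul1mx mulmx1.
rewrite -/(eisom_lin g) -/(eisom_trans g).
rewrite !mulmxDr mulmxN !mulmxA => /colP E; apply/colP => i; move: (E i).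
rewrite -[eisom_trans (translation x)]/x.
rewrite !(mulmxN, mulmxDl, mulNmx, mulmx1, mul1mx).
rewrite !mxE; lra.
Qed.

Section Automorphism.
Variable f : G -> G.
Hypothesis f_aut : automorphisms G f.

(** The criterion [commute_conjP] for being a translation is purely group-theoretic, so f preserves
    it. *)
Lemma aut_translation v : L v ->
  f (gtransl v) = gtransl (eisom_trans (val (f (gtransl v)))).
Proof.
case: f_aut => -[f' fK f'K] fM Lv; apply: gtranslP.
apply: (commute_conjP _).2 => h; rewrite -(f'K h).
have fV x : f x^-1%g = (f x)^-1%g.
  apply: (@mulgI _ (f x)); rewrite -fM !mulgV.
  by apply: (@mulgI _ (f 1%g)); rewrite -fM !mulg1.
rewrite conjgE -fV -!fM /commute -!fM -conjgE; congr f.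
by apply: (commute_conjP _).1; rewrite val_gtransl.
Qed.

Lemma aut_lattice_map : exists Phi : 'M[R]_n, forall v, L v ->
  L (Phi *m v) /\ f (gtransl v) = gtransl (Phi *m v).
Proof.
pose phi v := eisom_trans (val (f (gtransl v))).
have Lphi v : L (phi v) by apply/eisom_trans_in/valP.
have [_ fM] := f_aut.
have E v : L v -> f (gtransl v) = gtransl (phi v) by exact: aut_translation.
have [x y Lx Ly|Phi PhiE] := @centered_additive R n d d_gt0 phi.
  have Lxy := centeredD Lx Ly; have Lpxy := centeredD (Lphi x) (Lphi y).
  by apply: gtransl_inj; rewrite // gtranslD // -!E // gtranslD.
exists Phi => v Lv; rewrite -PhiE //; split=> //; exact: aut_translation.
Qed.

(** Apply f to the relation [gtranslC] and cancel [f g]: the two sides agree on every v in L. This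
    is how Phi normalizes the point group. *)
Lemma aut_lattice_equiv (Phi : 'M[R]_n) :
  (forall v, L v -> L (Phi *m v) /\ f (gtransl v) = gtransl (Phi *m v)) ->
  forall g, eisom_lin (val (f g)) *m Phi = Phi *m eisom_lin (val g).
Proof.
move=> PhiP g; apply: (centered_eqmx d_gt0) => v Lv; have [_ fM] := f_aut.
have [LPv fv] := PhiP _ Lv; have [_ Lg] := eisom_lin_symmetry (valP g).
have [_ Lfg] := eisom_lin_symmetry (valP (f g)).
have [LPg fgv] := PhiP _ ((Lg v).2 Lv).
move/(congr1 f): (gtranslC g Lv); rewrite !fM fv fgv gtranslC //.
move=> /mulIg /gtransl_inj.
by rewrite !mulmxA; apply; [rewrite -mulmxA; exact/Lfg | rewrite -mulmxA].
Qed.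

End Automorphism.
End CenteredGroup.

(** * All automorphisms are inner, given two properties of the point group *)

Section CenteredOut.
Variables (R : realType) (n : nat) (d : 'I_n -> R).
Hypothesis d_gt0 : forall i, 0 < d i.

Local Notation L := (centered d).
Local Notation Gamma := (lattice_group L).
Local Notation G := (subgroup_type Gamma).
Local Notation gtransl := (@gtransl R n d).

Hypothesis n_gt0 : (0 < n)%N.
(** Makes squared norms on L natural numbers, so that a shortest nonzero vector exists. *)
Hypothesis d_sq : forall i, exists m : nat, d i ^+ 2 = m%:R.
(** To be applied to M = Phi^T Phi. *)
Hypothesis irreducible : forall M : 'M[R]_n, M^T = M ->
  (forall A, lattice_symmetry L A -> A *m M = M *m A) -> exists c, M = c%:M.
(** The point group fixes only the zero class of L/2L. *)
Hypothesis fixed_mod2 : forall c, L c ->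
  (forall A, lattice_symmetry L A -> exists2 w, L w & A *m c - c = w *+ 2) ->
  exists2 w, L w & c = w *+ 2.

Definition sqnorm (x : 'cV[R]_n) : R := (x^T *m x) 0 0.

Lemma sqnormE x : sqnorm x = \sum_i x i 0 ^+ 2.
Proof. by rewrite /sqnorm mxE; apply: eq_bigr => i _; rewrite mxE expr2. Qed.

Lemma sqnorm_gt0 x : x != 0 -> 0 < sqnorm x.
Proof.
move=> x0; rewrite lt0r sqnormE sumr_ge0 ?andbT => [|i _]; last exact: sqr_ge0.
apply: contra x0; rewrite psumr_eq0 => [/allP x0|i _]; last exact: sqr_ge0.
apply/eqP/colP => i; rewrite mxE; apply/eqP.
by rewrite -sqrf_eq0; apply: x0; rewrite mem_index_enum.
Qed.

Lemma sqnorm_nat x : L x -> exists k : nat, sqnorm x = k%:R.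
Proof.
move=> [z xz _]; have [m dm] := choice d_sq.
exists (\sum_i m i * `|z i| ^ 2)%N.
rewrite sqnormE natr_sum; apply: eq_bigr => i _.
rewrite xz exprMn dm natrM natrX natr_absz intr_norm real_normK ?num_real //.
Qed.

(* Phi multiplies squared norms by c and maps a shortest nonzero vector of L to a
   nonzero vector of L. *)
Lemma similarity_ge1 (Phi Psi : 'M[R]_n) c :
  Psi *m Phi = 1%:M -> (forall x, L x -> L (Phi *m x)) ->
  Phi^T *m Phi = c%:M -> 1 <= c.
Proof.
move=> PsiPhi LPhi Phic.
have Phi0 x : x != 0 -> Phi *m x != 0.
  apply: contraNneq => Px0.
  by rewrite -[x]mul1mx -PsiPhi -mulmxA Px0 mulmx0.
have sqPhi x : sqnorm (Phi *m x) = c * sqnorm x.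
  rewrite /sqnorm trmx_mul -mulmxA [Phi^T *m _]mulmxA Phic mul_scalar_mx.
  by rewrite -scalemxAr mxE.
pose P k := `[< exists x, [/\ L x, x != 0 & sqnorm x = k%:R] >].
have exP : exists k, P k.
  pose x := centered_vec d (Ordinal n_gt0).
  have Lx : L x := centered_vecP d _.
  have [k xk] := sqnorm_nat Lx; exists k; apply/asboolP; exists x; split=> //.
  apply/eqP => /colP /(_ (Ordinal n_gt0)); rewrite !mxE !eqxx mulr1.
  by move/eqP; rewrite mulf_eq0 pnatr_eq0 /= gt_eqF.
have [k /asboolP [x [Lx x0 xk]] kmin] := ex_minnP exP.
have [l Pxl] := sqnorm_nat (LPhi _ Lx).
have : (k <= l)%N.
  by apply: kmin; apply/asboolP; exists (Phi *m x); split; auto.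
rewrite -(ler_nat R) -Pxl -xk sqPhi -[leLHS]mul1r ler_pM2r //.
exact: sqnorm_gt0.
Qed.

(** Phi scales squared norms by c and its inverse Psi by 1/c; both preserve L, so [similarity_ge1]
    bounds c from both sides. *)
Lemma similarity_orthogonal (Phi Psi : 'M[R]_n) :
  Psi *m Phi = 1%:M ->
  (forall x, L x -> L (Phi *m x)) -> (forall x, L x -> L (Psi *m x)) ->
  (exists c, Phi^T *m Phi = c%:M) -> Phi *m Phi^T = 1%:M.
Proof.
move=> PsiPhi LPhi LPsi [c Phic].
have c1 := similarity_ge1 PsiPhi LPhi Phic.
have PhiPsi := mulmx1C PsiPhi.
have PhiT : Phi^T = c *: Psi.
  by rewrite -[LHS]mulmx1 -PhiPsi mulmxA Phic mul_scalar_mx.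
have c0 : c != 0 by apply: lt0r_neq0; lra.
have PsiE : Psi = c^-1 *: Phi^T by rewrite PhiT scalerA mulVf // scale1r.
have Psic : Psi^T *m Psi = (c^-1)%:M.
  rewrite {1}PsiE [(_ *: _)^T]linearZ /= trmxK -scalemxAl PhiPsi.
  by rewrite scalemx1.
have := similarity_ge1 PhiPsi LPsi Psic.
rewrite invr_ge1 ?unitfE //; last by lra.
move=> c1'; apply: mulmx1C; rewrite Phic; congr _%:M; lra.
Qed.

Lemma aut_fix_translations (f : G -> G) :
  {morph f : x y / (x * y)%g} ->
  (forall v, L v -> f (gtransl v) = gtransl v) ->
  exists h : G, forall g, f g = (g ^ h)%g.
Proof.
move=> fM ftr; have [NN NL] := opp_symmetry d.
have f_lin g : eisom_lin (val (f g)) = eisom_lin (val g).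
  apply: (centered_eqmx d_gt0) => v Lv.
  have [_ Lg] := eisom_lin_symmetry (valP g).
  have [_ Lfg] := eisom_lin_symmetry (valP (f g)).
  have := congr1 f (gtranslC g Lv); rewrite !fM !ftr ?gtranslC //;
    last exact/Lg.
  by move=> /mulIg /gtransl_inj; apply; [exact/Lfg|exact/Lg].
pose N := gorth d NN.
have valN : val N = orthogonal_isom NN by exact: val_gorth.
(* These relations survive under f, and they control the translation parts of the images. *)
have commN A (AA : A *m A^T = 1%:M) : (forall x, L (A *m x) <-> L x) ->
    (gorth d AA * N = N * gorth d AA)%g.
  move=> LA; apply: val_inj; rewrite !val_subM valN val_gorth //.
  apply: eisom_ext; rewrite ?eisom_linM ?eisom_transM /eisom_lin /eisom_trans /=.
    by rewrite mulmxN mulNmx mulmx1 mul1mx.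
  by rewrite !mulmx0.
have transN g : (g * f N = f N * g)%g ->
    eisom_lin (val g) *m eisom_trans (val (f N)) + eisom_trans (val g) =
    eisom_trans (val (f N)) - eisom_trans (val g).
  move=> /(congr1 (fun g : G => eisom_trans (val g))) /=.
  rewrite !eisom_transM => ->.
  rewrite -[eisom_lin (sval (f N))]/(eisom_lin (val (f N))) f_lin valN.
  by rewrite /eisom_lin /= mulNmx mul1mx addrC.
have [A [AA LA]|w Lw cw] := fixed_mod2 (eisom_trans_in (valP (f N))).
  (* With c and a the translation parts of [f N] and [f (gorth d AA)], [transN] reads A c + a = c -
     a, that is A c - c = - 2a. *)
  exists (- eisom_trans (val (f (gorth d AA)))).
    exact/centeredN/eisom_trans_in/valP.
  have := transN (f (gorth d AA)); rewrite -!fM commN // f_lin val_gorth //.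
  move=> /(_ erefl) /= /colP E; apply/colP => i; move: (E i).
  by rewrite mulr2n !mxE /= => {}E; lra.
have fN : f N = (gtransl w * gtransl w * N)%g.
  rewrite -gtranslD // -mulr2n -cw; apply: val_inj.
  rewrite val_subM val_gtransl ?valN; last exact/eisom_trans_in/valP.
  apply: eisom_ext; first by rewrite f_lin valN eisom_linM mul1mx.
  by rewrite eisom_transM mulmx0 add0r.
(* [f N] is the point reflection x |-> 2w - x about w; this conjugation moves its center back to
   0. *)
pose f2 g := (f g ^ gtransl w)%g.
have f2M : {morph f2 : x y / (x * y)%g} by move=> x y; rewrite /f2 fM conjMg.
have f2_lin g : eisom_lin (val (f2 g)) = eisom_lin (val g).
  rewrite !val_subM !eisom_linM f_lin val_gtransl // mulmx1 eisom_linV.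
  by rewrite val_gtransl // trmx1 mul1mx.
have f2tr v : L v -> f2 (gtransl v) = gtransl v.
  move=> Lv; rewrite /f2 ftr // conjgE -gtranslD // addrC gtranslD //.
  by rewrite mulKg.
have f2N : f2 N = N.
  apply: (@mulgI _ (gtransl w)); rewrite -conjgC gtranslC // f_lin valN.
  rewrite mulNmx mul1mx fN !mulgA -gtranslD //; last exact: centeredN.
  rewrite addNr -gtranslD ?add0r //; exact: centered0.
exists (gtransl w)^-1%g => g; apply: (canRL (conjgK _)); rewrite -/(f2 g).
have Lt := eisom_trans_in (valP g); have [AA LA] := eisom_lin_symmetry (valP g).
have -> : g = (gtransl (eisom_trans (val g)) * gorth d AA)%g.
  apply: val_inj; rewrite val_subM val_gtransl // val_gorth //.
  apply: eisom_ext.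
    by rewrite eisom_linM mul1mx.
  by rewrite eisom_transM mulmx0 add0r.
rewrite f2M f2tr //; congr (_ * _)%g; apply: val_inj; apply: eisom_ext.
  exact: f2_lin.
(* The image of [gorth d AA] under [f2] still commutes with N, so its translation part equals its
   own opposite and vanishes. *)
have := congr1 f2 (commN _ AA LA); rewrite !f2M f2N.
move/(congr1 (fun g : G => eisom_trans (val g))).
rewrite !val_subM !eisom_transM.
rewrite valN /eisom_lin /= mulmx0 mulNmx mul1mx => /colP E.
rewrite val_gorth //; apply/colP => i; move: (E i); rewrite !mxE => {}E.
lra.
Qed.

Lemma aut_inner (f : G -> G) : automorphisms G f ->
  exists h : G, forall g, f g = (g ^ h)%g.
Proof.
move=> f_aut; have [[f' fK f'K] fM] := f_aut.
have f'_aut : automorphisms G f'.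
  split; first by exists f.
  by move=> x y; apply: (can_inj fK); rewrite fM !f'K.
have [Phi PhiP] := aut_lattice_map d_gt0 f_aut.
have [Psi PsiP] := aut_lattice_map d_gt0 f'_aut.
have PsiPhi : Psi *m Phi = 1%:M.
  apply: (centered_eqmx d_gt0) => v Lv; rewrite mul1mx -mulmxA.
  have [LPv fv] := PhiP _ Lv; have [LPPv f'v] := PsiP _ LPv.
  by apply: (gtransl_inj LPPv Lv); rewrite -f'v -fv fK.
have equiv := aut_lattice_equiv d_gt0 f_aut PhiP.
have LPhi x : L x -> L (Phi *m x) by move=> /PhiP [].
have LPsi x : L x -> L (Psi *m x) by move=> /PsiP [].
have PhiO : Phi *m Phi^T = 1%:M.
  apply: (similarity_orthogonal PsiPhi LPhi LPsi); apply: irreducible.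
    by rewrite trmx_mul trmxK.
  move=> A [AA LA].
  have E := equiv (gorth d AA); rewrite val_gorth // in E.
  have A'A' := eisom_linKl (val (f (gorth d AA))).
  rewrite /= in E A'A'.
  move: (eisom_lin (sval (f (gorth d AA)))) E A'A' => A' E A'A'.
  (* From Phi A = A' Phi with A' orthogonal; multiplying by A on the left shows that Phi^T Phi
     commutes with A. *)
  have {E A'A'} : A^T *m (Phi^T *m Phi) *m A = Phi^T *m Phi.
    rewrite mulmxA -mulmxA -trmx_mul -[_ *m A]E trmx_mul.
    by rewrite -mulmxA [A'^T *m _]mulmxA A'A' mul1mx.
  by move=> {1}<-; rewrite !mulmxA AA mul1mx.
have symPhi x : L (Phi *m x) <-> L x.
  split=> [/LPsi|]; last exact: LPhi.
  by rewrite mulmxA PsiPhi mul1mx.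
pose h := gorth d PhiO.
(* Conjugation by h sends the translation by Phi v back to the one by v, so the corrected map fixes
   all translations. *)
have [k fk] : exists k : G, forall g, (f g ^ h = g ^ k)%g.
  apply: (@aut_fix_translations (fun g => f g ^ h)%g).
    by move=> x y; rewrite fM conjMg.
  move=> v Lv; have [LPv ->] := PhiP _ Lv.
  by apply: (@mulgI _ h); rewrite -conjgC gtranslC // val_gorth.
by exists (k * h^-1)%g => g; rewrite conjgM -fk conjgK.
Qed.

Lemma outer_centered :
  outer_automorphisms G = [set inner_automorphisms G].
Proof.
have innerE f : automorphisms G f ->
    [set f \o i | i in inner_automorphisms G] = inner_automorphisms G.
  move=> /aut_inner [h fh]; apply/seteqP.
  split=> [_ [_ [g _ <-] <-]|_ [g _ <-]].
    by exists (g * h)%g => //; apply/funext => x; rewrite /= fh conjgM.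
  exists (fun x => x ^ (g * h^-1))%g; first by exists (g * h^-1)%g.
  by apply/funext => x; rewrite /= fh -conjgM -mulgA mulVg mulg1.
apply/seteqP; split=> [_ [f f_aut <-]|_ ->] /=; first exact: innerE.
(* The identity provides a coset, so the set of cosets is not empty. *)
have id_aut : automorphisms G id by split=> //; exists id.
by exists id => //; exact: innerE.
Qed.

End CenteredOut.

(** * Compact sets of matrices and isometries *)

Lemma vec_mx_continuous (T : topologicalType) m n :
  continuous (@vec_mx T m n).
Proof.
move=> v A [P vP PA]; exists (fun _ k => mxvec (\matrix_(i, j) P i j) 0 k).
  move=> i k; rewrite ord1; case/mxvec_indexP: k => {}i j.
  by rewrite mxvecE mxE; have := vP i j; rewrite mxE.
move=> w vw; apply: PA => i j; have := vw 0 (mxvec_index i j).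
by rewrite mxvecE !mxE.
Qed.

(** Flattening matrices to row vectors reduces this to [rV_compact], on products of compact sets. *)
Lemma mx_box_compact (R : realType) m n (c : R) :
  compact [set A : 'M[R]_(m, n) | forall i j, A i j \in `[- c, c]].
Proof.
have -> : [set A : 'M[R]_(m, n) | forall i j, A i j \in `[- c, c]] =
    vec_mx @` [set v : 'rV_(m * n) | forall k, v 0 k \in `[- c, c]].
  apply/seteqP; split=> [A Ac|_ [v vc <-] i j]; last by rewrite mxE.
  exists (mxvec A); last exact: mxvecK.
  by move=> k; case/mxvec_indexP: k => i j; rewrite mxvecE.
apply: continuous_compact.
  exact/continuous_subspaceT/vec_mx_continuous.
apply: (@rV_compact R _ (fun=> `[- c, c]%classic)) => _.
exact: segment_compact.
Qed.

Lemma orthogonal_entry_le1 (R : realType) n (A : 'M[R]_n) i j :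
  A *m A^T = 1%:M -> `|A i j| <= 1.
Proof.
move=> AA; have : \sum_k A i k ^+ 2 = 1.
  transitivity ((A *m A^T) i i); last by rewrite AA mxE eqxx.
  by rewrite mxE; apply: eq_bigr => k _; rewrite mxE expr2.
rewrite (bigD1 j) //= -(@expr_le1 _ 2) // real_normK ?num_real // => <-.
by rewrite lerDl sumr_ge0 // => k _; exact: sqr_ge0.
Qed.

Lemma orthogonal_compact (R : realType) n :
  compact [set A : 'M[R]_n | A *m A^T = 1%:M].
Proof.
apply: subclosed_compact (@mx_box_compact R n n 1) _ => [|A /= AA i j].
  have -> : [set A : 'M[R]_n | A *m A^T = 1%:M] =
      \bigcap_(ij in setT) [set A |
        (A *m A^T) ij.1 ij.2 = (1%:M : 'M[R]_n) ij.1 ij.2].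
    apply/seteqP; split=> [A /= AA ij _ /=|A AA]; first by rewrite AA.
    by apply/matrixP => i j; exact: (AA (i, j)).
  apply: closed_bigI => -[i j] _ /=.
  apply: (@closed_comp _ _ (fun A : 'M[R]_n => (A *m A^T) i j)
    [set y | y = (1%:M : 'M[R]_n) i j]); last exact: closed_eq.
  move=> A _.
  have -> : (fun A : 'M[R]_n => (A *m A^T) i j) =
      (fun A => \sum_k A i k * A j k).
    by apply/funext => B; rewrite mxE; apply: eq_bigr => k _; rewrite mxE.
  apply: (cvg_big add_continuous (nbhs_filter A)) => k _.
  by apply: (@cvgM _ _ (nbhs A) (nbhs_filter A)); exact: coord_continuous.
by rewrite in_itv /= -ler_norml orthogonal_entry_le1.
Qed.

(** The topology of [eisom] is pulled back along [eisom_val]: a cluster point of the image filter,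
    found in a product of two compact sets, lifts to a cluster point of F. *)
Lemma eisom_box_compact (R : realType) n (c : R) :
  compact [set g : eisom R n | forall i, eisom_trans g i 0 \in `[- c, c]].
Proof.
move=> F FF Fc.
have K := compact_setX (@orthogonal_compact R n) (@mx_box_compact R n 1 c).
have [|p [[/= p1 p2] pF]] := K (@eisom_val R n @ F) _.
  apply: (@filterS _ F _ _ _ _ Fc) => g /= gc.
  split; first exact: (eqP (eisom_orthogonal g)).
  by move=> i j; rewrite ord1; exact: gc.
pose g := @EIsom R n p (introT eqP p1); exists g; split.
  by move=> i; exact: p2.
move=> A B FA [_ [[U Uo <-] Ug UB]].
have [h [[k Ak <-] Uk]] := pF (@eisom_val R n @` A) U
  (filterS (@preimage_image _ _ _ A) FA) (open_nbhs_nbhs (conj Uo Ug)).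
by exists k; split=> //; exact: UB.
Qed.

(** * Discreteness and cocompactness *)

Section CenteredCrystallographic.
Variables (R : realType) (n : nat) (d : 'I_n -> R).
Hypothesis d_ge1 : forall i, 1 <= d i.
Hypothesis d_le2 : forall i, d i <= 2.

Local Notation L := (centered d).
Local Notation Gamma := (lattice_group L).

Let d_gt0 i : 0 < d i. Proof. exact: lt_le_trans (d_ge1 i). Qed.

Lemma centered_small x : L x -> (forall i, `|x i 0| < 1) -> x = 0.
Proof.
move=> [z xz _] x1; apply/colP => i; rewrite mxE xz.
have := x1 i; rewrite xz normrM gtr0_norm // => dz1.
have : `|(z i)%:~R| < 1 :> R.
  by apply: le_lt_trans dz1; rewrite ler_peMl.
rewrite -intr_norm -[1]/(1%:~R) ltr_int => z1.
have -> : z i = 0 by lia.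
by rewrite mulr0.
Qed.

Lemma centered_discrete : discrete_subgroup Gamma.
Proof.
move=> g Gg; split; first exact/mem_set.
(* Applied to [centered_vec d j], differences of linear parts are scaled by 2 d_j <= 4; radius 1/4
   keeps the entries below 1, where [centered_small] applies. *)
exists (@eisom_val R n @^-1` ball (eisom_val g) (4^-1)).
  by apply: initial_continuous; apply: nbhsx_ballx; lra.
apply/seteqP; split=> [h [/= [[_ glin] [_ gtrans]] Gh]|_ ->]; last first.
  by split=> //=; apply: ballxx; lra.
have hg_lin : eisom_lin h = eisom_lin g.
  apply/matrixP => i j.
  have Lgh : L ((eisom_lin h - eisom_lin g) *m centered_vec d j).
    have Lj := centered_vecP d j.
    rewrite mulmxBl; apply: centeredB.
      by have [_ Lh] := eisom_lin_symmetry Gh; exact/Lh.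
    by have [_ Lg] := eisom_lin_symmetry Gg; exact/Lg.
  have gh_entry k : ((eisom_lin h - eisom_lin g) *m centered_vec d j) k 0 =
      2 * d j * (eisom_lin h k j - eisom_lin g k j).
    by rewrite -scalemxAr -colE !mxE.
  have /colP /(_ i) : (eisom_lin h - eisom_lin g) *m centered_vec d j = 0.
    apply: centered_small => // k; rewrite gh_entry normrM.
    have := glin k j; rewrite /ball /= distrC -/(eisom_lin h) -/(eisom_lin g).
    have d2 := d_le2 j; have d1 := d_ge1 j.
    rewrite [`|2 * _|]ger0_norm; last lra.
    move: (eisom_lin h k j - _) => u u4.
    have := ler_wpM2r (normr_ge0 u) d2; rewrite -mulrA.
    lra.
  rewrite gh_entry mxE => /eqP; rewrite mulf_eq0 gt_eqF /=; last first.
    by rewrite mulr_gt0.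
  by rewrite subr_eq0 => /eqP.
apply: eisom_ext => //; apply/eqP; rewrite -subr_eq0; apply/eqP.
apply: centered_small; first exact/centeredB/eisom_trans_in/Gg/eisom_trans_in.
move=> i; have := gtrans i 0; rewrite /ball /= distrC !mxE.
rewrite -/(eisom_trans h) -/(eisom_trans g).
lra.
Qed.

Lemma centered_cocompact : cocompact_subgroup Gamma.
Proof.
pose c := \sum_i 2 * d i.
rewrite /cocompact_subgroup; set Q := coset_space _.
have -> : [set: Q] = \pi_Q @` [set g : eisom R n |
    forall i, eisom_trans g i 0 \in `[- c, c]].
  apply/seteqP; split=> // q _.
  (* For g = (A, a) and w = A^T a, the coset of g contains g t_v, with translation part A (v + w).
     Rounding w by multiples of 2 d_i puts each entry of v + w in [0, 2 d_i), and entries of A have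
     absolute value at most 1, whence the bound c. *)
  pose g := repr q; pose w := (eisom_lin g)^T *m eisom_trans g.
  pose z i := Num.floor (w i 0 / (2 * d i)).
  pose v : 'cV[R]_n := \col_i (d i * (- (2 * z i))%:~R).
  have Lv : L v.
    exists (fun i => - (2 * z i)) => [i|i j]; first by rewrite mxE.
    have -> : - (2 * z i) - - (2 * z j) = 2 * (z j - z i) by lia.
    by rewrite dvdz_mulr.
  exists (g * translation v)%g.
    move=> i; rewrite eisom_transM.
    have -> : eisom_lin g *m v + eisom_trans g = eisom_lin g *m (v + w).
      by rewrite mulmxDr mulmxA eisom_linKr mul1mx.
    rewrite in_itv /= -ler_norml mxE.
    apply: le_trans (ler_norm_sum _ _ _) _; apply: ler_sum => j _.
    rewrite normrM -[leRHS]mul1r ler_pM //.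
      exact/orthogonal_entry_le1/eisom_linKr.
    have d0 := d_gt0 j; have d20 : 0 < 2 * d j by rewrite mulr_gt0.
    have zle := floor_le (w j 0 / (2 * d j)).
    have zgt := floorD1_gt (w j 0 / (2 * d j)).
    have -> : (v + w) j 0 = 2 * d j * (w j 0 / (2 * d j) - (z j)%:~R).
      rewrite mulrBr mulrCA mulfV ?gt_eqF // mulr1 !mxE.
      rewrite mulrNz intrM; lra.
    rewrite ger0_norm; last by apply: mulr_ge0; [exact: ltW|rewrite subr_ge0].
    rewrite -[leRHS]mulr1 ler_pM2l //.
    move: zgt; rewrite -/(z j) intrD; lra.
  rewrite -[RHS]reprK; apply/eqmodP; rewrite /= /lcoset_rel.
  by rewrite invgM -mulgA mulVg mulg1 gpredV; exact: translation_in.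
apply: continuous_compact; last exact: eisom_box_compact.
exact/continuous_subspaceT/pi_continuous.
Qed.

End CenteredCrystallographic.

(** * Consequences of the coordinate reflections *)

Section Reflections.
Variables (R : realType) (n : nat) (d : 'I_n -> R).
Hypothesis d_gt0 : forall i, 0 < d i.

Local Notation L := (centered d).

Lemma involution_symmetry (A : 'M[R]_n) : A^T = A -> A *m A = 1%:M ->
  (forall x, L x -> L (A *m x)) -> lattice_symmetry L A.
Proof.
move=> At AA LA; split; first by rewrite At.
by move=> x; split=> [/LA|/LA //]; rewrite mulmxA AA mul1mx.
Qed.

Definition sign_flip (i : 'I_n) : 'M[R]_n := 1%:M - 2 *: delta_mx i i.

Lemma sign_flipE i (x : 'cV[R]_n) k :
  (sign_flip i *m x) k 0 = (if k == i then - 1 else 1) * x k 0.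
Proof.
rewrite mulmxBl mul1mx -scalemxAl !mxE (bigD1 i) //= big1 => [|j ji].
  by rewrite !mxE eqxx andbT addr0; case: eqP => [->|_] /=; lra.
by rewrite !mxE (negPf ji) andbF mul0r.
Qed.

Lemma sign_flip_symmetry i : lattice_symmetry L (sign_flip i).
Proof.
apply: involution_symmetry.
- by rewrite /sign_flip linearB /= linearZ /= trmx1 trmx_delta.
- rewrite {2}/sign_flip mulmxBr mulmx1 -scalemxAr /sign_flip mulmxBl mul1mx.
  rewrite -scalemxAl mul_delta_mx; apply/matrixP => k l; rewrite !mxE; lra.
move=> x [z xz z2]; exists (fun k => if k == i then - z k else z k) => [k|k l].
  by rewrite sign_flipE xz; case: eqP => _; rewrite ?mulrNz; lra.
by have := z2 k l; case: eqP => _; case: eqP => _; lia.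
Qed.

(** Multiplication by [sign_flip k] negates the entry (k, l) from the left but not from the
    right. *)
Lemma sym_commutant_diag (M : 'M[R]_n) k l :
  (forall A, lattice_symmetry L A -> A *m M = M *m A) -> k != l -> M k l = 0.
Proof.
move=> /(_ _ (sign_flip_symmetry k)) + kl; rewrite mulmxBl mulmxBr mul1mx mulmx1.
move/matrixP/(_ k l); rewrite -scalemxAl -scalemxAr !mxE.
rewrite (bigD1 k) //= big1 => [|j jk]; last by rewrite mxE (negPf jk) andbF mul0r.
rewrite big1 => [|j _]; last by rewrite mxE [l == k]eq_sym (negPf kl) andbF mulr0.
by rewrite mxE !eqxx /=; lra.
Qed.

Hypothesis n_gt1 : (1 < n)%N.

(** Flipping the sign at i changes c by 2w, where w has integer coordinate - z_i at i and 0
    elsewhere; w in L forces z_i to be even. So c = 2y with y integral, perhaps outside L, and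
    invariance of c modulo 2L becomes A y - y in L. *)
Lemma sym_fixed_mod2_even c : L c ->
  (forall A, lattice_symmetry L A -> exists2 w, L w & A *m c - c = w *+ 2) ->
  exists2 t : 'I_n -> int, forall i, c i 0 = 2 * (d i * (t i)%:~R) &
    forall A, lattice_symmetry L A ->
      L (A *m (\col_i (d i * (t i)%:~R)) - \col_i (d i * (t i)%:~R)).
Proof.
move=> [z cz z2] cfix.
have z_even i : (2 %| z i)%Z.
  have [w [y wy y2] cw] := cfix _ (sign_flip_symmetry i).
  have [k ki] : exists k : 'I_n, k != i.
    have : (0 < #|~: [set i]|)%N.
      by have := cardsC [set i]; rewrite cards1 card_ord; lia.
    by move=> /card_gt0P [k]; rewrite !inE => ki; exists k.
  have wE l : w l 0 = if l == i then - (d i * (z i)%:~R) else 0.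
    move/colP/(_ l): cw; rewrite mulr2n mxE sign_flipE [(- c) l 0]mxE.
    rewrite [(w + w) l 0]mxE cz.
    by case: eqP => [->|_]; lra.
  have yi : y i = - z i.
    apply: (@intr_inj R); apply: (mulfI (lt0r_neq0 (d_gt0 i))).
    by rewrite -wy wE eqxx mulrNz mulrN.
  have yk : y k = 0.
    apply: (@intr_inj R); apply: (mulfI (lt0r_neq0 (d_gt0 k))).
    by rewrite -wy wE (negPf ki) mulr0.
  by have := y2 i k; rewrite yi yk; lia.
have ct i : c i 0 = 2 * (d i * (z i %/ 2)%Z%:~R).
  by rewrite cz -[in LHS](divzK (z_even i)) intrM; lra.
exists (fun i => (z i %/ 2)%Z) => // A /cfix [w Lw cw].
set y := \col_i _.
have cy : c = y *+ 2 by apply/colP => i; rewrite mulr2n !mxE ct; lra.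
suff -> : A *m y - y = w by [].
have : (A *m y - y) *+ 2 = w *+ 2 by rewrite -cw cy raddfMn mulrnBl.
by move/colP => E; apply/colP => i; move: (E i); rewrite !mulr2n mxE [RHS]mxE; lra.
Qed.

Lemma sym_commutant_scalar (M : 'M[R]_n) :
  (forall A, lattice_symmetry L A -> A *m M = M *m A) ->
  (forall i j, M i i = M j j) -> exists c, M = c%:M.
Proof.
move=> Mc Md; exists (M (Ordinal n_gt1) (Ordinal n_gt1)).
apply/matrixP => k l; rewrite mxE.
by case: eqVneq => [->|kl]; [exact: Md|exact: sym_commutant_diag Mc kl].
Qed.

End Reflections.

(** * The body-centered cubic lattice, n >= 3 *)

Section HighDimension.
Variables (R : realType) (n : nat).
Hypothesis n_gt2 : (2 < n)%N.

Definition bcc_scale : 'I_n -> R := fun=> 1.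
Local Notation L := (centered bcc_scale).

Lemma transposition_symmetry i j : lattice_symmetry L (tperm_mx i j).
Proof.
apply: involution_symmetry.
- exact: tr_tperm_mx.
- by rewrite -perm_mxM tperm2 perm_mx1.
move=> x [z xz z2]; exists (fun k => z (tperm i j k)) => [k|k l]; last exact: z2.
by rewrite -row_permE mxE xz.
Qed.

Lemma bcc_irreducible (M : 'M[R]_n) :
  (forall A, lattice_symmetry L A -> A *m M = M *m A) -> exists c, M = c%:M.
Proof.
move=> Mc; have n_gt1 := ltnW n_gt2; apply: (sym_commutant_scalar n_gt1 Mc) => i j.
have := Mc _ (transposition_symmetry i j).
rewrite /tperm_mx -row_permE -{2}tpermV -col_permE => /matrixP /(_ j i).
by rewrite !mxE tpermR tpermL.
Qed.

Lemma bcc_fixed_mod2 c : L c ->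
  (forall A, lattice_symmetry L A -> exists2 w, L w & A *m c - c = w *+ 2) ->
  exists2 w, L w & c = w *+ 2.
Proof.
move=> Lc /(sym_fixed_mod2_even (fun=> ltr01) (ltnW n_gt2) Lc) [t ct Lt].
exists (\col_i (bcc_scale i * (t i)%:~R)); last first.
  by apply/colP => i; rewrite mulr2n !mxE ct /bcc_scale; lra.
exists t => [i|i j]; first by rewrite mxE.
(* Swapping i and j changes y by a vector of L with coordinate t_i - t_j at j and 0 at a third index
   k, so t_i and t_j have equal parity. In dimension 2 there is no such k, hence the other lattice
   there. *)
have [k /norP [ki kj]] : exists k : 'I_n, ~~ ((k == i) || (k == j)).
  have : (0 < #|~: [set i; j]|)%N.
    by have := cardsC [set i; j]; rewrite cards2 card_ord; lia.
  by move=> /card_gt0P [k]; rewrite !inE => kij; exists k.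
have [z] := Lt _ (transposition_symmetry j i).
rewrite /tperm_mx -row_permE => zE /(_ j k).
have zE' l : z l = t (tperm j i l) - t l.
  by apply: (@intr_inj R); have := zE l; rewrite !mxE !mul1r rmorphB.
by rewrite !zE' tpermL tpermD ?subrr ?subr0 // eq_sym.
Qed.

End HighDimension.

(** * The hexagonal lattice, n = 2 *)

Section Plane.
Variable R : realType.

Local Notation s := (Num.sqrt (3 : R)).
Definition hex_scale (i : 'I_2) : R := if i == 0 then 1 else s.
Local Notation L := (centered hex_scale).

Lemma sqr_sqrt3 : s * s = 3.
Proof. by rewrite -expr2 sqr_sqrtr. Qed.

Lemma sqrt3_gt0 : 0 < s. Proof. by rewrite sqrtr_gt0. Qed.

Lemma hex_ge1 i : 1 <= hex_scale i.
Proof.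
rewrite /hex_scale; case: ifP => // _.
by have := sqr_sqrt3; have := sqrt3_gt0; nra.
Qed.

Lemma hex_le2 i : hex_scale i <= 2.
Proof.
rewrite /hex_scale; case: ifP => [_|_]; first lra.
by have := sqr_sqrt3; have := sqrt3_gt0; nra.
Qed.

Lemma ord2E (i : 'I_2) : {i = 0} + {i = 1}.
Proof. by case: i => -[|[|//]] i2; [left|right]; exact: val_inj. Qed.

(** Reflection in the line at angle pi/6; together with the sign flips it generates the symmetries
    of the hexagon. *)
Definition hex_reflection : 'M[R]_2 := \matrix_(i, j)
  if i == 0 then (if j == 0 then 2^-1 else s / 2)
  else (if j == 0 then s / 2 else - 2^-1).

Lemma sum2 (V : zmodType) (F : 'I_2 -> V) : \sum_i F i = F 0 + F 1.
Proof.
rewrite !big_ord_recl big_ord0 addr0; congr (F _ + F _); exact: val_inj.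
Qed.

Lemma hex_reflection_symmetry : lattice_symmetry L hex_reflection.
Proof.
have ss := sqr_sqrt3.
apply: involution_symmetry.
- apply/matrixP => i j; rewrite !mxE.
  by case: (ord2E i) => ->; case: (ord2E j) => ->.
- apply/matrixP => i j; rewrite !mxE sum2 !mxE.
  by case: (ord2E i) => ->; case: (ord2E j) => -> /=; nra.
move=> x [z xz z2].
have [k zk] : exists k, z 0 = z 1 + 2 * k.
  by exists ((z 0%R - z 1%R) %/ 2)%Z; have := z2 0 1; lia.
(* The image has coordinates (z_0 + 3 z_1)/2 and (z_0 - z_1)/2, rewritten with z_0 = z_1 + 2k. *)
exists (fun i => if i == 0 then 2 * z 1 + k else k) => [i|i j].
  have zkR : (z 0)%:~R = (z 1)%:~R + 2 * k%:~R :> R by rewrite zk intrD intrM.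
  rewrite mxE sum2 !mxE !xz /hex_scale zkR.
  case: (ord2E i) => -> /=; rewrite ?intrD ?intrM.
    transitivity (2^-1 * (1 * ((z 1)%:~R + 2 * k%:~R)) +
      (s * s) / 2 * (z 1)%:~R); first lra.
    rewrite ss; lra.
  lra.
by case: (ord2E i) => ->; case: (ord2E j) => -> /=; lia.
Qed.

Lemma hex_irreducible (M : 'M[R]_2) :
  (forall A, lattice_symmetry L A -> A *m M = M *m A) -> exists c, M = c%:M.
Proof.
move=> Mc; apply: (sym_commutant_scalar _ Mc) => //.
have M01 : M 0 1 = 0 by apply: (sym_commutant_diag Mc).
have M10 : M 1 0 = 0 by apply: (sym_commutant_diag Mc).
have M0011 : M 0 0 = M 1 1.
  (* M is diagonal, so the entry (0, 1) compares M_00 and M_11 up to the nonzero factor s/2. *)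
  have := Mc _ hex_reflection_symmetry => /matrixP /(_ 0 1).
  rewrite !mxE !sum2 !mxE /= M01 mulr0 mul0r add0r addr0 mulrC.
  by move/mulIf => -> //; rewrite mulf_neq0 // gt_eqF // sqrt3_gt0.
by move=> i j; case: (ord2E i) => ->; case: (ord2E j) => ->.
Qed.

Lemma hex_fixed_mod2 c : L c ->
  (forall A, lattice_symmetry L A -> exists2 w, L w & A *m c - c = w *+ 2) ->
  exists2 w, L w & c = w *+ 2.
Proof.
have d_gt0 i : 0 < hex_scale i by apply: lt_le_trans (hex_ge1 i).
move=> Lc /(sym_fixed_mod2_even d_gt0 (isT : (1 < 2)%N) Lc) [t ct Lt].
exists (\col_i (hex_scale i * (t i)%:~R)); last first.
  by apply/colP => i; rewrite mulr2n !mxE ct; lra.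
exists t => [i|]; first by rewrite mxE.
have [z zE _] := Lt _ hex_reflection_symmetry.
have t01 : (2 %| t 0%R - t 1%R)%Z.
  (* First coordinate of A y - y for y = (t_0, s t_1): t_0/2 + 3 t_1/2 - t_0. *)
  have : 3 * t 1 - t 0 = 2 * z 0.
    apply: (@intr_inj R); have := zE 0.
    rewrite intrB !intrM !mxE sum2 !mxE /hex_scale /=.
    have -> : s / 2 * (s * (t 1)%:~R) = (s * s) / 2 * (t 1)%:~R by lra.
    by rewrite sqr_sqrt3; lra.
  lia.
by move=> i j; case: (ord2E i) => ->; case: (ord2E j) => ->; lia.
Qed.

End Plane.

Theorem theorem2p2 (R : realType) (n : nat) (hn : (2 <= n)%N) :
  exists Gamma : groupClosed (eisom R n),
    [/\ crystallographic Gamma,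
        group_center (subgroup_type Gamma) = [set 1%g] &
        outer_automorphisms (subgroup_type Gamma) =
          [set inner_automorphisms (subgroup_type Gamma)]].
Proof.
have [n2|n2] := ltnP 2 n.
  have d1 (i : 'I_n) : (1 <= bcc_scale R i)%R by [].
  have d2 (i : 'I_n) : (bcc_scale R i <= 2)%R by rewrite /bcc_scale; lra.
  have d0 (i : 'I_n) : (0 < bcc_scale R i)%R by [].
  exists (lattice_group (centered (@bcc_scale R n))); split.
  - split; [exact: centered_discrete|exact: centered_cocompact].
  - exact: center_centered.
  - apply: outer_centered => //.
    + exact: ltnW (ltnW n2).
    + by move=> i; exists 1%N; rewrite expr1n.
    + by move=> M _; exact: (bcc_irreducible n2).
    + exact: (bcc_fixed_mod2 n2).
have {hn n2} -> : n = 2 by lia.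
have d1 := @hex_ge1 R; have d2 := @hex_le2 R.
have d0 (i : 'I_2) : (0 < hex_scale R i)%R by apply: lt_le_trans (d1 i).
exists (lattice_group (centered (@hex_scale R))); split.
- split; [exact: centered_discrete|exact: centered_cocompact].
- exact: center_centered.
- apply: outer_centered => //.
  + move=> i; rewrite /hex_scale; case: ifP => _.
      by exists 1%N; rewrite expr1n.
    by exists 3%N; rewrite sqr_sqrtr.
  + by move=> M _; exact: hex_irreducible.
  + exact: hex_fixed_mod2.
Qed.
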